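(* Let $k\ge 1$ be an integer, $n=2k+1$, and let $C_n^-$ be an unbalanced signed cycle on $n$ vertices. Then the spectrum of $D^{\pm}(C_n^-)$, counted with multiplicity, consists of the eigenvalue $$k(-1)^k-\frac{1-(-1)^k}{2}$$ with multiplicity $1$, together with, for each $j=0,1,2,\ldots,k-1$, the eigenvalue $$\frac{k(-1)^j}{\sin\left((2j+1)\frac{\pi}{2n}\right)}-\frac{\sin^2\left((2j+1)\frac{k\pi}{2n}\right)}{\sin^2\left((2j+1)\frac{\pi}{2n}\right)}$$ with multiplicity $2$.
   Context: A signed graph $\Sigma=(G,\sigma)$ consists of an underlying graph $G=(V,E)$ and a signature $\sigma:E\to\{1,-1\}$. The sign of a path or cycle is the product of the signs of its edges. A signed cycle is a signed graph whose underlying graph is a cycle; it is unbalanced if the product of the signs of all its edges is $-1$. Let $d(u,v)$ be the usual graph distance in $G$ (connected). For vertices $u,v$, let $\sigma_{\max}(u,v)=-1$ if all shortest $uv$-paths have sign $-1$, and $+1$ otherwise; let $\sigma_{\min}(u,v)=+1$ if all shortest $uv$-paths have sign $+1$, and $-1$ otherwise. The signed distance matrices are $D^{\max}(\Sigma)=(\sigma_{\max}(u,v)d(u,v))$ and $D^{\min}(\Sigma)=(\sigma_{\min}(u,v)d(u,v))$; when they are equal, the common matrix is denoted $D^{\pm}(\Sigma)$. In an odd cycle any two vertices are joined by a unique shortest path, so $D^{\pm}$ is defined and its $(u,v)$ entry is $d(u,v)$ times the sign of the unique shortest $uv$-path. Eigenvalues for different values of $j$ are listed separately; if listed values coincide,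 their multiplicities add. *)

(* Defs.v *)
From HB Require Import structures.
From mathcomp Require Import all_boot all_order all_algebra.
From mathcomp Require Import all_classical all_reals all_analysis.

Set Implicit Arguments.
Unset Strict Implicit.
Unset Printing Implicit Defensive.

Import Order.TTheory GRing.Theory Num.Theory.

Local Open Scope ring_scope.

(* Edges are two-element vertex sets. The values of the signature outside the
   edge set play no role: they are never used in the definitions below. *)
Record signed_graph (T : finType) := SignedGraph {
  edges : {set {set T}};
  signature : {set T} -> int;
  card_edge : forall e, e \in edges -> #|e| = 2%N;
  signatureP : forall e, e \in edges -> signature e = 1 \/ signature e = -1
}.

Section SignedGraph.
Variables (T : finType) (S : signed_graph T).

Definition adj : rel T := fun u v => [set u; v]%SET \in edges S.

(* The path with vertices u :: p, without repeated vertices, from u to v;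
   its length is size p. *)
Definition is_uvpath (u v : T) (p : seq T) : bool :=
  [&& path adj u p, uniq (u :: p) & last u p == v].

Definition path_sign (u : T) (p : seq T) : int :=
  \prod_(s <- pairmap (fun x y => signature S [set x; y]%SET) u p) s.

(* Length of a shortest uv-path: the least l for which there is a uv-path of
   length l. A path has fewer than #|T| edges, and the default value
   #|T| is taken exactly when u and v are not connected. *)
Definition gdist (u v : T) : nat :=
  find (fun l => [exists p : l.-tuple T, is_uvpath u v p]) (iota 0 #|T|).

Definition is_shortest (u v : T) (p : seq T) : bool :=
  is_uvpath u v p && (size p == gdist u v).

Definition sigma_max (u v : T) : int :=
  if `[< forall p, is_shortest u v p -> path_sign u p = -1 >] then -1 else 1.

Definition sigma_min (u v : T) : int :=
  if `[< forall p, is_shortest u v p -> path_sign u p = 1 >] then 1 else -1.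

(* Rows and columns are indexed by the vertices through their enumeration. *)
Definition Dmax (R : pzRingType) : 'M[R]_#|T| :=
  \matrix_(i, j) (let u := enum_val i in let v := enum_val j in
                  (sigma_max u v)%:~R * (gdist u v)%:R).

Definition Dmin (R : pzRingType) : 'M[R]_#|T| :=
  \matrix_(i, j) (let u := enum_val i in let v := enum_val j in
                  (sigma_min u v)%:~R * (gdist u v)%:R).

(* D^{+-} is defined only when Dmax and Dmin agree, hence a predicate. *)
Definition is_Dpm (R : pzRingType) (D : 'M[R]_#|T|) : Prop :=
  Dmax R = D /\ Dmin R = D.

(* The underlying graph is a cycle: c lists all vertices in cyclic order. *)
Definition signed_cycle : Prop :=
  exists c : seq T,
    [/\ (2 < size c)%N, uniq c, forall x : T, x \in c
      & edges S = [set [set x; next c x]%SET | x : T]%SET].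

Definition unbalanced_cycle : Prop :=
  signed_cycle /\ \prod_(e in edges S) signature S e = -1.

End SignedGraph.

(* s lists pairs (eigenvalue, algebraic multiplicity); a value occurring in
   several pairs gets the sum of the multiplicities. *)
Definition has_spectrum (R : comNzRingType) (n : nat) (A : 'M[R]_n)
    (s : seq (R * nat)) : Prop :=
  char_poly A = \prod_(am <- s) ('X - am.1%:P) ^+ am.2.

(* Main.v *)
Require Import Defs.
From HB Require Import structures.
From mathcomp Require Import all_boot all_order all_algebra.
From mathcomp Require Import all_classical all_reals all_analysis.
From mathcomp Require Import ring lra zify.

Set Implicit Arguments.
Unset Strict Implicit.
Unset Printing Implicit Defensive.

Import Order.TTheory GRing.Theory Num.Theory.

Local Open Scope ring_scope.

(** The spectrum is computed on a universal cover of the cycle. Let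
    [x : nat -> T] wind around the cycle, [x (i + n) = x i] with [n = 2k+1],
    and let [t i] be the product of the signs of the first [i] steps. A path
    that starts at [x a] lifts to the line and ends at some [x b]; its sign is
    [t a * t b] and its length is at least [|a - b|] ([path_lift]). Lifts of one
    vertex are [n] apart, so a vertex has exactly one lift at distance at most
    [k] from [a]. Hence all shortest paths between [x a] and [x b] have the same
    sign, and the matrix entry is [t a * t b * |a - b|] whenever [|a - b| <= k].

    Being unbalanced means [t (i + n) = - t i]. The functions
    [cas (i * theta)], with [cas = cos + sin] the Hartley kernel and
    [theta = (2j+1) pi / n], also change sign under [i |-> i + n], so
    [t i * cas (i * theta)] is well defined on the vertices. Applying the matrix
    to it means summing [|m| cas ((a + m) theta)] over [-k <= m <= k]; the terms
    [m] and [-m] add up to [2 m cos (m theta) cas (a theta)], so it is an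
    eigenvector with eigenvalue [2 * \sum_(m <= k) m cos (m theta)]
    ([cas_eigen], [Dmax_eigenmx]). The kernel [cas] gives a real basis directly:
    the [n] functions are orthogonal ([cas_orthogonal]), so the matrix
    is diagonalised and its characteristic polynomial is known
    ([char_poly_cover]).

    It remains to put the eigenvalues in closed form ([weighted_cos_closed],
    where [sin (n theta / 2) = (-1) ^ j]) and to see that [j] and [n - 1 - j]
    give the same value, while [j = k] is its own partner
    ([prod_listed_eigenvalues]). *)

(** * Characteristic polynomial from an eigenbasis *)

(** The relation between [D] and the diagonal matrix survives in polynomial
    matrices, as [char_poly_mx D * F = F * char_poly_mx L]; taking determinants
    avoids any inverse of [F]. *)
Lemma char_poly_eigenbasis (K : fieldType) (m : nat) (D F : 'M[K]_m)
    (l : 'I_m -> K) :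
  \det F != 0 -> D *m F = F *m diag_mx (\row_j l j) ->
  char_poly D = \prod_(j < m) ('X - (l j)%:P).
Proof.
move=> F0 DF; set L := diag_mx _ in DF.
have cpL : char_poly L = \prod_(j < m) ('X - (l j)%:P).
  rewrite char_poly_trig ?diag_mx_is_trig //.
  by apply: eq_bigr => j _; rewrite !mxE eqxx mulr1n.
have /(congr1 determinant) : char_poly_mx D *m map_mx polyC F
                           = map_mx polyC F *m char_poly_mx L.
  rewrite /char_poly_mx mulmxBl mulmxBr -!map_mxM DF.
  by rewrite scalar_mxC.
rewrite !det_mulmx [RHS]mulrC -/(char_poly D) -/(char_poly L) cpL.
by apply: mulIf; rewrite det_map_mx polyC_eq0.
Qed.

(** * Trigonometric sums *)

Section Trigonometry.
Variable R : realType.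
Implicit Types (x y : R) (i j k m n : nat).

Lemma sinDnatpi x m : sin (x + m%:R * pi) = (-1) ^+ m * sin x.
Proof. by rewrite mulr_natl (alternatingn (@sinDpi R)). Qed.

Lemma cosDnatpi x m : cos (x + m%:R * pi) = (-1) ^+ m * cos x.
Proof. by rewrite mulr_natl (alternatingn (@cosDpi R)). Qed.

(** Multiplying by [2 sin y] makes the sum telescope; the step is [2 * y] so that
    no half angle appears. *)
Lemma sum_cos_dirichlet y n :
  2 * sin y * \sum_(i < n) cos (i%:R * (2 * y))
  = sin ((2 * n%:R - 1) * y) + sin y.
Proof.
elim: n => [|n IHn].
  by rewrite big_ord0 !mulr0 sub0r mulN1r sinN addNr.
rewrite big_ord_recr /= mulrDr IHn.
rewrite (_ : (2 * n.+1%:R - 1) * y = n%:R * (2 * y) + y); last by ring.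
rewrite (_ : (2 * n%:R - 1) * y = n%:R * (2 * y) - y); last by ring.
by rewrite sinB sinD; ring.
Qed.

Lemma sum_sin_dirichlet y n :
  2 * sin y * \sum_(i < n) sin (i%:R * (2 * y))
  = cos y - cos ((2 * n%:R - 1) * y).
Proof.
elim: n => [|n IHn].
  by rewrite big_ord0 !mulr0 sub0r mulN1r cosN subrr.
rewrite big_ord_recr /= mulrDr IHn.
rewrite (_ : (2 * n.+1%:R - 1) * y = n%:R * (2 * y) + y); last by ring.
rewrite (_ : (2 * n%:R - 1) * y = n%:R * (2 * y) - y); last by ring.
by rewrite cosB cosD; ring.
Qed.

Lemma sin_eq0_mul2n y i : sin y = 0 -> sin (i%:R * (2 * y)) = 0.
Proof.
move=> s0; elim: i => [|i IHi]; first by rewrite mul0r sin0.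
rewrite (_ : i.+1%:R * (2 * y) = i%:R * (2 * y) + (y + y)); last by ring.
by rewrite !sinD IHi s0; ring.
Qed.

Lemma sum_cos_roots n m : (0 < m < n)%N ->
  \sum_(i < n) cos (i%:R * (2 * (m%:R * pi / n%:R))) = 0 :> R.
Proof.
move=> /andP[m0 mn]; have n0 : (0 < n)%N by lia.
set y : R := m%:R * pi / n%:R.
have sy : 0 < sin y.
  apply: sin_gt0_pi; rewrite /y divr_gt0 ?mulr_gt0 ?pi_gt0 ?ltr0n //=.
  by rewrite ltr_pdivrMr ?ltr0n // mulrC ltr_pM2l ?pi_gt0 ?ltr_nat.
have := sum_cos_dirichlet y n.
have -> : (2 * n%:R - 1) * y = - y + (2 * m)%:R * pi.
  by rewrite /y; field; rewrite pnatr_eq0; lia.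
rewrite sinDnatpi mulnC exprM sqrr_sign mul1r sinN addNr.
by move/eqP; rewrite mulf_eq0 (gt_eqF (mulr_gt0 _ sy)) // => /eqP.
Qed.

(** Unlike the sum of cosines, this one also vanishes when [n] divides [m]: then
    every term is zero. *)
Lemma sum_sin_roots n m : (0 < n)%N ->
  \sum_(i < n) sin (i%:R * (2 * (m%:R * pi / n%:R))) = 0 :> R.
Proof.
move=> n0; set y : R := m%:R * pi / n%:R.
have [sy|sy] := eqVneq (sin y) 0.
  by apply: big1 => i _; rewrite sin_eq0_mul2n.
have := sum_sin_dirichlet y n.
have -> : (2 * n%:R - 1) * y = - y + (2 * m)%:R * pi.
  by rewrite /y; field; rewrite pnatr_eq0; lia.
rewrite cosDnatpi cosN mulnC exprM sqrr_sign mul1r subrr.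
by move/eqP; rewrite !mulf_eq0 (negPf sy) pnatr_eq0 => /eqP.
Qed.

(** The kernel of the Hartley transform. *)
Definition cas x := cos x + sin x.

Lemma casM x y : cas x * cas y = cos (x - y) + sin (x + y).
Proof. by rewrite /cas cosB sinD; ring. Qed.

(** The arguments of the [n]-th roots of [-1]. *)
Definition angle n j : R := (2 * j + 1)%:R * (pi / n%:R).

Lemma cas_antiperiodic n j i : (0 < n)%N ->
  cas ((i + n)%:R * angle n j) = - cas (i%:R * angle n j).
Proof.
move=> n0.
have -> : (i + n)%:R * angle n j = i%:R * angle n j + (2 * j + 1)%:R * pi.
  by rewrite /angle natrD mulrDl; congr (_ + _); field; rewrite pnatr_eq0; lia.
rewrite /cas cosDnatpi sinDnatpi exprD mulnC exprM sqrr_sign expr1.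
by ring.
Qed.

(** By [casM] each product splits into the cosine of a difference of angles and the
    sine of a sum of angles. Both are even multiples of [pi / n], so the sums
    over a period vanish, except for the cosines when [j = l]. *)
Lemma cas_orthogonal n j l : (j < n)%N -> (l < n)%N ->
  \sum_(i < n) cas (i%:R * angle n j) * cas (i%:R * angle n l)
  = n%:R *+ (j == l).
Proof.
wlog lj : j l / (l <= j)%N.
  move=> W jn ln; case: (leqP l j) => [|/ltnW] h; first exact: W.
  by rewrite eq_sym -W //; apply: eq_bigr => i _; rewrite mulrC.
move=> jn ln; have n0 : (0 < n)%N by lia.
under eq_bigr => i _.
  rewrite casM -mulrBr -mulrDr.
  have -> : angle n j - angle n l = 2 * ((j - l)%:R * pi / n%:R).
    by rewrite /angle natrB //; field; rewrite pnatr_eq0; lia.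
  have -> : angle n j + angle n l = 2 * ((j + l + 1)%:R * pi / n%:R).
    by rewrite /angle; field; rewrite pnatr_eq0; lia.
over.
rewrite big_split /= sum_sin_roots // addr0.
have [->|jl] := eqVneq j l; last by rewrite sum_cos_roots //; lia.
rewrite subnn; under eq_bigr => i _ do rewrite !mul0r !mulr0 cos0.
by rewrite sumr_const card_ord mulr1n.
Qed.

Definition weighted_cos k x : R := \sum_(m < k.+1) m%:R * cos (m%:R * x).

Lemma sum_centered (f : nat -> R) k :
  \sum_(m < (2 * k).+1) f m
  = f k + \sum_(m < k) (f (k - m.+1)%N + f (k + m.+1)%N).
Proof.
rewrite -(big_mkord xpredT f) mul2n -addnn -addnS.
rewrite (big_cat_nat (n := k)) ?leq_addr //= [X in _ + X]big_ltn; last lia.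
rewrite addrCA; congr (_ + _); rewrite big_split /=; congr (_ + _).
  rewrite big_nat_rev /= big_mkord; apply: eq_bigr => m _; congr f; lia.
rewrite -{1}[k.+1]add0n big_addn (_ : (k + k.+1 - k.+1 = k)%N); last lia.
by rewrite big_mkord; apply: eq_bigr => m _; congr f; lia.
Qed.

(** The weight [|m - k|] is written with truncated subtractions, one of which is
    zero. It is symmetric about the centre [k], where [cas] at opposite offsets
    adds up to a multiple of the central value: this makes [cas] an
    eigenfunction for every angle [x]. *)
Lemma cas_eigen k c x :
  \sum_(m < (2 * k).+1) ((m - k) + (k - m))%:R * cas ((c + m)%:R * x)
  = 2 * weighted_cos k x * cas ((c + k)%:R * x).
Proof.
rewrite (sum_centered (fun m => ((m - k) + (k - m))%:R * cas ((c + m)%:R * x))).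
rewrite subnn mul0r add0r /weighted_cos big_ord_recl mul0r add0r.
rewrite mulr_sumr mulr_suml; apply: eq_bigr => -[m mk] _ /=.
rewrite /bump /= add1n.
have -> : (k - m.+1 - k + (k - (k - m.+1)) = m.+1)%N by lia.
have -> : (k + m.+1 - k + (k - (k + m.+1)) = m.+1)%N by lia.
have -> : (c + (k - m.+1))%:R * x = (c + k)%:R * x - m.+1%:R * x.
  by rewrite -mulrBl -natrB; last lia; congr (_%:R * _); lia.
have -> : (c + (k + m.+1))%:R * x = (c + k)%:R * x + m.+1%:R * x.
  by rewrite addnA natrD mulrDl.
by rewrite /cas cosB sinB cosD sinD; ring.
Qed.

Lemma sin_sqrB x y : sin x ^+ 2 - sin y ^+ 2 = sin (x + y) * sin (x - y).
Proof.
transitivity (sin x ^+ 2 * cos y ^+ 2 - cos x ^+ 2 * sin y ^+ 2).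
  by rewrite !cos2sin2; ring.
by rewrite sinB sinD; ring.
Qed.

(** Induction on [k]: [sin_sqrB] turns the increment of the squared sine into a
    multiple of [sin y], and the two remaining sines differ by
    [2 cos ((2k + 2) y) sin y]. *)
Lemma weighted_cos_closed k y : sin y != 0 ->
  2 * weighted_cos k (2 * y)
  = k%:R * sin ((2 * k + 1)%:R * y) / sin y - sin (k%:R * y) ^+ 2 / sin y ^+ 2.
Proof.
move=> s0; elim: k => [|k IHk].
  by rewrite /weighted_cos big_ord_recr big_ord0 /= !mul0r sin0; ring.
rewrite /weighted_cos big_ord_recr /= -/(weighted_cos _ _) mulrDr IHk.
have -> : sin (k.+1%:R * y) ^+ 2
    = sin ((2 * k + 1)%:R * y) * sin y + sin (k%:R * y) ^+ 2.
  apply/(canRL (subrK _)); rewrite sin_sqrB.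
  by congr (sin _ * sin _); ring.
have -> : sin ((2 * k.+1 + 1)%:R * y)
    = sin ((2 * k + 1)%:R * y) + 2 * cos (k.+1%:R * (2 * y)) * sin y.
  rewrite (_ : (2 * k.+1 + 1)%:R * y = k.+1%:R * (2 * y) + y); last by ring.
  rewrite (_ : (2 * k + 1)%:R * y = k.+1%:R * (2 * y) - y); last by ring.
  by rewrite sinB sinD; ring.
by field.
Qed.

(** The angles of index [j] and [n - 1 - j] add up to [2 pi]. *)
Lemma weighted_cos_reflect n k j : (j < n)%N ->
  weighted_cos k (angle n (n - j.+1)) = weighted_cos k (angle n j).
Proof.
move=> jn; apply: eq_bigr => m _; congr (_ * _).
have -> : m%:R * angle n (n - j.+1)
    = - (m%:R * angle n j) + (2 * m)%:R * pi.
  by rewrite /angle natrD natrM natrB //; field; rewrite pnatr_eq0; lia.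
by rewrite cosDnatpi exprM sqrrN expr1n expr1n mul1r cosN.
Qed.

Definition listed_eigenvalue n k j : R :=
  k%:R * (-1) ^+ j / sin ((2 * j + 1)%:R * (pi / (2 * n)%:R))
  - sin ((2 * j + 1)%:R * (k%:R * pi / (2 * n)%:R)) ^+ 2
    / sin ((2 * j + 1)%:R * (pi / (2 * n)%:R)) ^+ 2.

(** With [y] half of the angle, [(2 * k + 1) * y = pi / 2 + j * pi], whose sine is
    [(-1) ^+ j]. *)
Lemma listed_eigenvalueE n k j : n = (2 * k + 1)%N -> (j < n)%N ->
  2 * weighted_cos k (angle n j) = listed_eigenvalue n k j.
Proof.
move=> nE jn; have n0 : (0 < n)%N by lia.
have -> : angle n j = 2 * ((2 * j + 1)%:R * (pi / (2 * n)%:R)).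
  by rewrite /angle; field; rewrite !pnatr_eq0; lia.
set y : R := (2 * j + 1)%:R * _.
have sy : sin y != 0.
  apply/lt0r_neq0/sin_gt0_pi.
  have n2 : 0 < (2 * n)%:R :> R by rewrite ltr0n; lia.
  have p0 := @pi_gt0 R.
  rewrite (_ : y = (2 * j + 1)%:R * pi / (2 * n)%:R); last by rewrite /y; ring.
  apply/andP; split; first by rewrite divr_gt0 ?mulr_gt0 ?ltr0n //; lia.
  by rewrite ltr_pdivrMr // mulrC ltr_pM2l // ltr_nat; lia.
rewrite weighted_cos_closed // /listed_eigenvalue -/y.
have -> : (2 * k + 1)%:R * y = pi / 2 + j%:R * pi.
  by rewrite /y -nE; field; rewrite !pnatr_eq0; lia.
rewrite sinDnatpi sin_pihalf mulr1.
by congr (_ - sin _ ^+ 2 / _); rewrite /y; ring.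
Qed.

Lemma listed_eigenvalue_mid n k : n = (2 * k + 1)%N ->
  listed_eigenvalue n k k = k%:R * (-1) ^+ k - (1 - (-1) ^+ k) / 2.
Proof.
move=> nE; rewrite /listed_eigenvalue.
have -> : (2 * k + 1)%:R * (pi / (2 * n)%:R) = pi / 2 :> R.
  by rewrite -nE; field; rewrite !pnatr_eq0; lia.
have -> : (2 * k + 1)%:R * (k%:R * pi / (2 * n)%:R) = k%:R * pi / 2 :> R.
  by rewrite -nE; field; rewrite !pnatr_eq0; lia.
rewrite sin_pihalf expr1n !divr1; congr (_ - _).
have := cosDnatpi 0 k; rewrite cos0 mulr1 add0r => <-.
rewrite [in RHS](_ : k%:R * pi = (k%:R * pi / 2) *+ 2 :> R); last first.
  by rewrite -mulr_natr; field.
by rewrite cos_mulr2n cos2sin2; field.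
Qed.

Lemma prod_listed_eigenvalues n k : n = (2 * k + 1)%N ->
  \prod_(j < n) ('X - (2 * weighted_cos k (angle n j))%:P)
  = ('X - (listed_eigenvalue n k k)%:P)
    * \prod_(j < k) ('X - (listed_eigenvalue n k j)%:P) ^+ 2.
Proof.
move=> nE; have nS : n = (k + k.+1)%N by lia.
rewrite -(big_mkord xpredT (fun j => 'X - (2 * weighted_cos k (angle n j))%:P)).
rewrite [X in index_iota 0 X]nS.
rewrite (big_cat_nat (n := k)) ?leq_addr //= [X in _ * X]big_ltn; last lia.
rewrite mulrCA listed_eigenvalueE //; last by lia.
congr (_ * _).
rewrite -{1}[k.+1]add0n big_addn (_ : (k + k.+1 - k.+1 = k)%N); last lia.
rewrite [X in _ * X]big_nat_rev /= !big_mkord -big_split /=.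
apply: eq_bigr => -[j jk] _ /=; rewrite expr2.
rewrite (_ : (0 + k - j.+1 + k.+1 = n - j.+1)%N); last by lia.
by rewrite weighted_cos_reflect ?listed_eigenvalueE //; lia.
Qed.
End Trigonometry.

(** * Distances and signs through the universal cover *)

Section Cover.
Variables (T : finType) (S : signed_graph T) (k : nat) (x : nat -> T).
Local Notation N := (2 * k).+1.
(* [x] walks along the cycle and its values repeat exactly with period [N]. *)
Hypothesis card_T : #|T| = N.
Hypothesis eq_x : forall i j, (x i == x j) = (i == j %[mod N]).
Hypothesis adj_x : forall i, adj S (x i) (x i.+1).
Hypothesis adj_xS : forall i v, adj S (x i.+1) v -> v = x i \/ v = x i.+2.

Let step_sign i := signature S [set x i; x i.+1]%SET.
Definition cover_sign i : int := \prod_(l < i) step_sign l.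
Local Notation t := cover_sign.

Hypothesis unbalanced : t N = -1.

Lemma cover_signS i : t i.+1 = t i * step_sign i.
Proof. by rewrite /t big_ord_recr. Qed.

Lemma cover_sign_pm i : t i = 1 \/ t i = -1.
Proof.
elim: i => [|i IHi]; first by left; rewrite /t big_ord0.
rewrite cover_signS /step_sign.
by case: (signatureP (adj_x i)) => ->; case: IHi => ->;
  rewrite ?mulr1 ?mul1r ?mulrNN; tauto.
Qed.

Lemma cover_sign_sq i : t i * t i = 1.
Proof. by case: (cover_sign_pm i) => ->. Qed.

Lemma step_signE i : step_sign i = t i * t i.+1.
Proof. by rewrite cover_signS mulrA cover_sign_sq mul1r. Qed.

Lemma xD i : x (i + N) = x i.
Proof. by apply/eqP; rewrite eq_x modnDr. Qed.

Lemma cover_signD i : t (i + N) = - t i.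
Proof.
elim: i => [|i IHi]; first by rewrite unbalanced /t big_ord0.
by rewrite addSn !cover_signS IHi mulNr /step_sign -addSn !xD.
Qed.

Lemma eq_x_near i j : (i - j + (j - i) < N)%N -> x i = x j -> i = j.
Proof.
wlog ij : i j / (i <= j)%N.
  move=> W; case: (leqP i j) => [|/ltnW] h; first exact: W.
  by rewrite addnC => d /esym /(W _ _ h) ->.
move=> d /eqP; rewrite eq_x eq_sym eqn_mod_dvd // => /dvdnP[q qE].
case: q qE => [|q]; [lia | rewrite mulSn; lia].
Qed.

(** Each step of the path moves the lift by one, up or down, and contributes the
    sign [t i * t i.+1]; the inner factors cancel in pairs. Starting at [a] at
    least as large as the length keeps the lift inside [nat]. *)
Lemma path_lift p a : (size p <= a)%N -> path (adj S) (x a) p ->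
  exists b, [/\ last (x a) p = x b, path_sign S (x a) p = t a * t b
              & (a - b + (b - a) <= size p)%N].
Proof.
elim: p a => [|v p IHp] a /=.
  move=> _ _; exists a; rewrite /path_sign big_nil cover_sign_sq.
  by split=> //; lia.
case: a => // a pa /andP[/adj_xS av pv].
rewrite /path_sign /= big_cons -/(path_sign S v p).
case: av pv => -> pv.
  have [|b [-> -> d]] := IHp a _ pv; first by lia.
  exists b; split=> //; last by lia.
  rewrite finset.setUC -/(step_sign a) step_signE.
  by rewrite mulrACA cover_sign_sq mul1r.
have [|b [-> -> d]] := IHp a.+2 _ pv; first by lia.
exists b; split=> //; last by lia.
rewrite -/(step_sign a.+1) step_signE.
by rewrite -mulrA [X in _ * X]mulrA cover_sign_sq mul1r.
Qed.

Lemma mkseq_uvpath (f : nat -> T) d :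
  (forall i, (i < d)%N -> adj S (f i) (f i.+1)) ->
  {in [pred i | (i <= d)%N] &, injective f} ->
  is_uvpath S (f 0%N) (f d) (mkseq (fun i => f i.+1) d).
Proof.
move=> fadj finj; apply/and3P; split.
- apply/(pathP (f 0%N)) => i; rewrite size_mkseq => id.
  rewrite nth_mkseq //.
  by case: i id => [|i] id /=; [|rewrite nth_mkseq; last lia]; apply: fadj.
- have -> : f 0%N :: mkseq (fun i => f i.+1) d = mkseq f d.+1.
    by rewrite /mkseq /= -[1%N]addn0 iotaDl -map_comp.
  apply/(mkseq_uniqP f) => i j id jd; apply: finj.
    by rewrite inE -ltnS.
  by rewrite inE -ltnS.
- by rewrite -nth_last size_mkseq; case: d {fadj finj} => //= d; rewrite nth_mkseq.
Qed.

Lemma straight_uvpath a b : (a - b + (b - a) <= k)%N ->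
  exists2 p, is_uvpath S (x a) (x b) p & size p = (a - b + (b - a))%N.
Proof.
have adjC u v : adj S u v = adj S v u by rewrite /adj finset.setUC.
case: (leqP a b) => [ab|/ltnW ba] dk.
  exists (mkseq (fun i => x (a + i.+1)) (b - a)); last by rewrite size_mkseq; lia.
  have := @mkseq_uvpath (fun i => x (a + i)) (b - a).
  rewrite addn0 subnKC //; apply=> [i _|i j]; first by rewrite addnS.
  by rewrite !inE => ib jb /eq_x_near; lia.
exists (mkseq (fun i => x (a - i.+1)) (a - b)); last by rewrite size_mkseq; lia.
have := @mkseq_uvpath (fun i => x (a - i)) (a - b).
rewrite subn0 subKn //; apply=> [i ib|i j].
  by rewrite adjC (_ : (a - i = (a - i.+1).+1)%N) //; lia.
by rewrite !inE => ib jb /eq_x_near; lia.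
Qed.

(** A path of length at most [k] must end at the lift [b] itself, since another
    lift of the same vertex is [N > 2 * k] away. *)
Lemma short_path_sign a b p : (k <= a)%N -> (a - b + (b - a) <= k)%N ->
  is_uvpath S (x a) (x b) p -> (size p <= k)%N ->
  path_sign S (x a) p = t a * t b /\ (a - b + (b - a) <= size p)%N.
Proof.
move=> ka dk /and3P[pp _ /eqP pb] pk.
have [|b' [b'E -> d]] := path_lift _ pp; first by lia.
suff -> : b = b' by [].
by apply: eq_x_near; [lia | rewrite -b'E].
Qed.

Lemma gdist_cover a b : (k <= a)%N -> (a - b + (b - a) <= k)%N ->
  gdist S (x a) (x b) = (a - b + (b - a))%N.
Proof.
move=> ka dk; have [p pP sp] := straight_uvpath dk; rewrite -sp in dk *.
rewrite /gdist; have -> : iota 0 #|T|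
    = iota 0 (size p) ++ size p :: iota (size p).+1 (2 * k - size p).
  by rewrite card_T (_ : N = size p + (2 * k - size p).+1)%N ?iotaD //; lia.
rewrite find_cat ifN /=; last first.
  apply/hasPn => l; rewrite mem_iota add0n => /= lp.
  apply/existsP => -[q qP].
  have := short_path_sign ka _ qP; rewrite size_tuple; lia.
rewrite size_iota ifT ?addn0 //.
by apply/existsP; exists (in_tuple p).
Qed.

Lemma shortest_sign a b p : (k <= a)%N -> (a - b + (b - a) <= k)%N ->
  is_shortest S (x a) (x b) p -> path_sign S (x a) p = t a * t b.
Proof.
move=> ka dk /andP[pP /eqP]; rewrite gdist_cover // => sp.
by have [] := short_path_sign ka dk pP _; rewrite ?sp.
Qed.

Lemma shortest_exists a b : (k <= a)%N -> (a - b + (b - a) <= k)%N ->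
  exists p, is_shortest S (x a) (x b) p.
Proof.
move=> ka dk; have [p pP sp] := straight_uvpath dk.
by exists p; rewrite /is_shortest pP gdist_cover //= sp.
Qed.

Lemma sigma_max_cover a b : (k <= a)%N -> (a - b + (b - a) <= k)%N ->
  sigma_max S (x a) (x b) = t a * t b.
Proof.
move=> ka dk; have [p pP] := shortest_exists ka dk.
rewrite /sigma_max; case: asboolP => [/(_ p pP) <-|np].
  exact: shortest_sign.
case: (cover_sign_pm a) (cover_sign_pm b) (@shortest_sign a b) => -> [] -> sh;
  rewrite ?mulr1 ?mulrNN ?mul1r //; case: np => q /sh ->; by rewrite ?mulr1 ?mul1r.
Qed.

Lemma sigma_min_cover a b : (k <= a)%N -> (a - b + (b - a) <= k)%N ->
  sigma_min S (x a) (x b) = t a * t b.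
Proof.
move=> ka dk; have [p pP] := shortest_exists ka dk.
rewrite /sigma_min; case: asboolP => [/(_ p pP) <-|np].
  exact: shortest_sign.
case: (cover_sign_pm a) (cover_sign_pm b) (@shortest_sign a b) => -> [] -> sh;
  rewrite ?mulr1 ?mulrNN ?mul1r //; case: np => q /sh ->; by rewrite ?mulr1 ?mulrNN.
Qed.

(** A window of [N] consecutive integers meets every vertex once. *)
Lemma window_bij c : bijective (fun m : 'I_N => x (c + m)).
Proof.
apply: inj_card_bij => [m m' /eqP|]; last by rewrite card_T card_ord.
rewrite eq_x eqn_modDl !modn_small ?ltn_ord // => /eqP; exact: val_inj.
Qed.

(** Every vertex is the centre of such a window; the matrix entries in its row can
    then all be read inside the window. *)
Lemma cover_window u : exists c, x (c + k) == u.
Proof.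
have [g gK Kg] := window_bij k.
by exists (g u); rewrite addnC Kg.
Qed.

Lemma Dmax_Dmin (R : pzRingType) : Dmax S R = Dmin S R.
Proof.
apply/matrixP => i j; rewrite !mxE /=.
have [c /eqP <-] := cover_window (enum_val i).
have [g _ Kg] := window_bij c.
rewrite -(Kg (enum_val j)); move: (g _) => m; have := ltn_ord m => mN.
by rewrite sigma_max_cover ?sigma_min_cover //; lia.
Qed.

(** * Diagonalisation *)

Section Spectrum.
Variable R : realType.

(** Both factors change sign when [i] grows by [N], so the product only depends
    on the vertex [x i]. *)
Definition eigenfun j i : R := (t i)%:~R * cas (i%:R * angle R N j).

Lemma eigenfun_periodic j i i' : x i = x i' -> eigenfun j i = eigenfun j i'.
Proof.
have per m q : eigenfun j (m + q * N) = eigenfun j m.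
  elim: q => [|q IHq]; first by rewrite addn0.
  rewrite mulSnr addnA -{}IHq /eigenfun cover_signD cas_antiperiodic //.
  by rewrite mulrNz mulrNN.
move/eqP; rewrite eq_x => /eqP ii'.
by rewrite (divn_eq i N) (divn_eq i' N) ii' ![(_ * N + _)%N]addnC !per.
Qed.

Definition lift_index (u : T) : nat := xchoose (cover_window u) + k.

Lemma lift_indexK u : x (lift_index u) = u.
Proof. exact/eqP/(xchooseP (cover_window u)). Qed.

Definition eigenmx : 'M[R]_#|T| :=
  \matrix_(i, j) eigenfun j (lift_index (enum_val i)).

Lemma Dmax_eigenmx :
  Dmax S R *m eigenmx
  = eigenmx *m diag_mx (\row_j (2 * weighted_cos k (angle R N j))).
Proof.
apply/matrixP => i j; rewrite mul_mx_diag !mxE.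
have [c /eqP uE] := cover_window (enum_val i).
transitivity (\sum_(v : T) (sigma_max S (x (c + k)) v)%:~R
    * (gdist S (x (c + k)) v)%:R * eigenfun j (lift_index v)).
  rewrite [RHS](reindex (@enum_val T predT)) /=; last exact/onW_bij/enum_val_bij.
  by apply: eq_bigr => l _; rewrite !mxE -uE.
rewrite (reindex _ (onW_bij _ (window_bij c))) /=.
rewrite -uE (@eigenfun_periodic j (lift_index (x (c + k))) (c + k)) ?lift_indexK //.
rewrite [in RHS]/eigenfun -mulrA [cas _ * _]mulrC -cas_eigen mulr_sumr.
apply: eq_bigr => m _; have := ltn_ord m => mN.
rewrite (@eigenfun_periodic j _ (c + m)) ?lift_indexK //.
rewrite sigma_max_cover ?gdist_cover //; try lia.
(* The sign of the column vertex occurs twice and cancels. *)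
rewrite !subnDl [(k - m + _)%N]addnC /eigenfun rmorphM /=.
have cancel_sign (e s d y : R) : s * s = 1 -> e * s * d * (s * y) = e * (d * y).
  by move=> ss; rewrite -[e in RHS]mul1r -ss; ring.
by apply: cancel_sign; rewrite -rmorphM /= cover_sign_sq.
Qed.

Lemma eigenmx_orthogonal : eigenmx^T *m eigenmx = N%:R%:M.
Proof.
apply/matrixP => i j; rewrite !mxE.
have ord_N (l : 'I_#|T|) : (l < N)%N by rewrite -card_T.
transitivity (\sum_(v : T) eigenfun i (lift_index v) * eigenfun j (lift_index v)).
  rewrite [RHS](reindex (@enum_val T predT)) /=; last exact/onW_bij/enum_val_bij.
  by apply: eq_bigr => l _; rewrite !mxE.
rewrite (reindex _ (onW_bij _ (window_bij 0))) /= -cas_orthogonal; try exact: ord_N.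
apply: eq_bigr => m _.
rewrite !(@eigenfun_periodic _ _ m) ?lift_indexK // /eigenfun mulrACA.
by rewrite -rmorphM /= cover_sign_sq mul1r.
Qed.

Lemma det_eigenmx_neq0 : \det eigenmx != 0.
Proof.
apply/eqP => d0; have /(congr1 determinant) := eigenmx_orthogonal.
rewrite det_mulmx d0 mulr0 det_scalar => /esym/eqP.
by rewrite expf_eq0 pnatr_eq0 andbF.
Qed.

Lemma char_poly_cover :
  char_poly (Dmax S R) = \prod_(j < N) ('X - (2 * weighted_cos k (angle R N j))%:P).
Proof.
rewrite (char_poly_eigenbasis det_eigenmx_neq0 Dmax_eigenmx).
rewrite -(big_mkord xpredT (fun j => 'X - (2 * weighted_cos k (angle R N j))%:P)).
by rewrite card_T big_mkord.
Qed.
End Spectrum.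
End Cover.

(** * The cover of a given cycle *)

Lemma set2_injr (T : finType) (u : T) : injective (fun v => [set u; v]%SET).
Proof.
move=> v w /= /setP E.
have := E v; rewrite !inE eqxx orbT => /esym/orP[]/eqP // vu.
have := E w; rewrite !inE eqxx orbT vu.
by rewrite orbb => /eqP.
Qed.

Section CycleCover.
Variables (T : finType) (S : signed_graph T) (k : nat) (x0 : T) (c : seq T).
Local Notation N := (2 * k).+1.
Hypotheses (k_gt0 : (0 < k)%N) (size_c : size c = N) (uniq_c : uniq c).
Hypothesis mem_c : forall u, u \in c.
Hypothesis edges_c : edges S = [set [set u; next c u]%SET | u : T]%SET.

Definition cyc i := nth x0 c (i %% N).

Lemma eq_cyc i j : (cyc i == cyc j) = (i == j %[mod N]).
Proof. by rewrite /cyc nth_uniq ?size_c ?ltn_pmod. Qed.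

Lemma cyc_index u : cyc (index u c) = u.
Proof. by rewrite /cyc modn_small ?nth_index // -size_c index_mem. Qed.

Lemma eq_cycS i j : (cyc i.+1 == cyc j.+1) = (cyc i == cyc j).
Proof. by rewrite !eq_cyc -[i.+1]addn1 -[j.+1]addn1 eqn_modDr. Qed.

Lemma cyc_SS_neq i : cyc i.+2 != cyc i.
Proof.
rewrite eq_cyc -addn2 -[X in _ != X %[mod _]]addn0 eqn_modDl.
by rewrite !modn_small //; lia.
Qed.

Lemma next_cyc i : next c (cyc i) = cyc i.+1.
Proof.
have iN : (i %% N < N)%N by rewrite ltn_pmod.
rewrite next_nth mem_c /cyc index_uniq ?size_c // -[i.+1]addn1 -modnDml addn1.
case: (c) size_c => //= y s [ss].
(* At the last vertex [next] falls back on the default value, the head of [c]. *)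
have [iE|iE] := eqVneq (i %% N)%N (2 * k)%N.
  by rewrite iE modnn nth_default ?ss.
rewrite [((i %% N).+1 %% N)%N]modn_small; last by lia.
by apply: set_nth_default; lia.
Qed.

Lemma adj_cyc i : adj S (cyc i) (cyc i.+1).
Proof. by rewrite /adj edges_c -next_cyc; apply/imsetP; exists (cyc i). Qed.

Lemma adj_cycS i v : adj S (cyc i.+1) v -> v = cyc i \/ v = cyc i.+2.
Proof.
rewrite /adj edges_c => /imsetP[u _].
rewrite -(cyc_index u) next_cyc; move: (index u c) => j E.
have : cyc i.+1 \in [set cyc j; cyc j.+1]%SET by rewrite -E set21.
rewrite !inE => /orP[] /eqP ij.
  right; apply: (@set2_injr _ (cyc i.+1)); rewrite /= E ij.
  by congr [set _; _]%SET; apply/eqP; rewrite eq_cycS ij.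
left; move/eqP: (ij); rewrite eq_cycS => /eqP ->.
by apply: (@set2_injr _ (cyc i.+1)); rewrite /= E ij finset.setUC.
Qed.

(** Distinct vertices give distinct edges because the cycle has more than two
    vertices ([cyc_SS_neq]). *)
Lemma prod_edges_cyc :
  \prod_(e in edges S) signature S e = cover_sign S cyc N.
Proof.
rewrite edges_c big_imset /=; last first.
  move=> u v _ _; rewrite -(cyc_index u) -(cyc_index v) !next_cyc.
  move: (index u c) (index v c) => i j E.
  have : cyc i \in [set cyc j; cyc j.+1]%SET by rewrite -E set21.
  rewrite !inE => /orP[] /eqP // ij.
  have /eqP : cyc i.+1 = cyc j.
    by apply: (@set2_injr _ (cyc i)); rewrite /= E ij finset.setUC.
  by rewrite -eq_cycS -ij (negPf (cyc_SS_neq i)).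
rewrite (reindex (fun m : 'I_N => cyc m)) /=.
  by apply: eq_bigr => m _; rewrite next_cyc.
apply/onW_bij; exists (fun u => inord (index u c)).
  move=> m; rewrite /cyc modn_small // index_uniq ?size_c //; exact: inord_val.
by move=> u; rewrite inordK ?cyc_index // -size_c index_mem.
Qed.
End CycleCover.

(** * The spectrum *)

Theorem theorem4p2 (R : realType) (k n : nat) (T : finType)
    (S : signed_graph T) (hk : (1 <= k)%N) (hn : n = (2 * k + 1)%N)
    (hT : #|T| = n) (hS : unbalanced_cycle S) :
  exists2 D : 'M[R]_#|T|, is_Dpm S D &
    has_spectrum D
      ((k%:R * (-1) ^+ k - (1 - (-1) ^+ k) / 2, 1%N) ::
       [seq (k%:R * (-1) ^+ j / sin ((2 * j + 1)%:R * (pi / (2 * n)%:R))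
             - sin ((2 * j + 1)%:R * (k%:R * pi / (2 * n)%:R)) ^+ 2
               / sin ((2 * j + 1)%:R * (pi / (2 * n)%:R)) ^+ 2, 2%N)
       | j <- iota 0 k]).
Proof.
have nE : n = (2 * k).+1 by rewrite hn addn1.
have [[c [_ uniq_c mem_c edges_c]] unbalanced] := hS.
have size_c : size c = (2 * k).+1.
  rewrite -nE -hT -(card_uniqP uniq_c).
  by apply: eq_card => u; rewrite mem_c.
have x0 : T by case: (c) size_c.
have unb : cover_sign S (cyc k x0 c) (2 * k).+1 = -1.
  by rewrite -(prod_edges_cyc x0 hk).
exists (Dmax S R).
  split=> //; apply/esym/(@Dmax_Dmin T S k (cyc k x0 c)) => //.
  - by rewrite hT.
  - exact: eq_cyc.
  - exact: adj_cyc.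
  - exact: adj_cycS.
rewrite /has_spectrum (@char_poly_cover T S k (cyc k x0 c)) //; first last.
  - exact: adj_cycS.
  - exact: adj_cyc.
  - exact: eq_cyc.
  - by rewrite hT.
rewrite -nE (prod_listed_eigenvalues R hn) big_cons /= expr1 big_map.
by rewrite -(listed_eigenvalue_mid R hn) -(big_mkord xpredT
  (fun j => ('X - (listed_eigenvalue R n k j)%:P) ^+ 2)) /index_iota subn0.
Qed.
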